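(* For every positive integer $n$, during a complete run of $\mathrm{AccelAsc}(n)$, the only read statement ''$x\leftarrow a_k+1$'' is executed exactly $p(n)-p(n-2)$ times.
   Context: $p(n)$ denotes the number of partitions of $n$, with the conventions $p(0)=1$ and $p(j)=0$ for $j<0$. The procedure $\mathrm{AccelAsc}(n)$, for $n\ge1$, operates on an array $a$ as follows and visits every ascending composition of $n$ (a sequence of positive integers in nondecreasing order summing to $n$) exactly once: 1. $k\leftarrow 2$; $a_1\leftarrow 0$; $y\leftarrow n-1$. 2. While $k\ne 1$: - $k\leftarrow k-1$; $x\leftarrow a_k+1$. - While $2x\le y$: $a_k\leftarrow x$; $y\leftarrow y-x$; $k\leftarrow k+1$. - $\ell\leftarrow k+1$. - While $x\le y$: $a_k\leftarrow x$; $a_\ell\leftarrow y$; visit $\langle a_1,\dots,a_\ell\rangle$; $x\leftarrow x+1$; $y\leftarrow y-1$. - $y\leftarrow y+x-1$; $a_k\leftarrow y+1$; visit $\langle a_1,\dots,a_k\rangle$. *)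

(* Defs.v *)
From mathcomp Require Import all_boot all_order all_algebra.

Set Implicit Arguments.
Unset Strict Implicit.
Unset Printing Implicit Defensive.

Definition is_partition (m : nat) (s : seq nat) : bool :=
  [&& sorted geq s, all (ltn 0) s & sumn s == m].

(* The bounds lose nothing: see [partition_bseq]. *)
Definition num_partitions (m : nat) : nat :=
  #|[set s : {bseq m of 'I_m.+1} | is_partition m (map val s)]|.

Lemma partition_bseq (m : nat) (s : seq nat) :
  is_partition m s -> exists t : {bseq m of 'I_m.+1}, map val t = s.
Proof.
case/and3P=> _ s_gt0 /eqP sum_s.
have size_s : size s <= m.
  rewrite -{}sum_s; elim: s s_gt0 => //= x s IHs /andP[x_gt0 /IHs le_s].
  by rewrite -add1n leq_add.
have le_s x : x \in s -> x < m.+1.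
  rewrite ltnS -{}sum_s; elim: s {s_gt0 size_s} => //= z s IHs.
  rewrite inE => /predU1P[->|/IHs le_x]; first exact: leq_addr.
  exact: leq_trans le_x (leq_addl _ _).
have eq_s : map val (map (@inord m) s) = s.
  rewrite -map_comp -[RHS]map_id; apply/eq_in_map => x /le_s lt_x /=.
  exact: inordK.
have size_t : size (map (@inord m) s) <= m by rewrite size_map.
by exists (Bseq size_t).
Qed.

Definition p (j : int) : nat :=
  match j with Posz m => num_partitions m | Negz _ => 0 end.

(* All the variables can be taken in nat because, for n >= 1, no subtraction of
   the procedure truncates: x >= 1 after each read (so y + x - 1 is exact),
   y - x and y - 1 are guarded by 2x <= y and x <= y respectively, and k >= 2 on
   entering the body of the outer loop. *)
Record state := State {
  vk : nat; vl : nat; vx : nat; vy : nat;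
  va : nat -> nat   (* va i is a_i; the array is indexed from 1 *)
}.

Definition set_k (f : state -> nat) (s : state) :=
  State (f s) (vl s) (vx s) (vy s) (va s).
Definition set_l (f : state -> nat) (s : state) :=
  State (vk s) (f s) (vx s) (vy s) (va s).
Definition set_x (f : state -> nat) (s : state) :=
  State (vk s) (vl s) (f s) (vy s) (va s).
Definition set_y (f : state -> nat) (s : state) :=
  State (vk s) (vl s) (vx s) (f s) (va s).
Definition set_a (i f : state -> nat) (s : state) :=
  State (vk s) (vl s) (vx s) (vy s)
    (fun j => if j == i s then f s else va s j).

Inductive event := Read | Visited of seq nat.

Definition is_read (e : event) : bool := if e is Read then true else false.

(* [ReadSucc] is the statement x <- a_k + 1; [Visit m] visits <a_1, ..., a_m>. *)
Inductive cmd :=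
  | Assign of (state -> state)
  | ReadSucc
  | Visit of (state -> nat)
  | Seq of cmd & cmd
  | While of (state -> bool) & cmd.

Declare Scope cmd_scope.
Delimit Scope cmd_scope with cmd.
Bind Scope cmd_scope with cmd.
Notation "c1 ;; c2" := (Seq c1 c2)
  (at level 90, right associativity) : cmd_scope.

(* [exec c s tr s']: started in s, the command c terminates in s', and tr is
   the chronological list of the reads and visits performed. *)
Inductive exec : cmd -> state -> seq event -> state -> Prop :=
  | exec_assign f s : exec (Assign f) s [::] (f s)
  | exec_read s :
      exec ReadSucc s [:: Read] (set_x (fun s => va s (vk s) + 1) s)
  | exec_visit m s :
      exec (Visit m) s [:: Visited [seq va s i | i <- iota 1 (m s)]] s
  | exec_seq c1 c2 s s1 s2 tr1 tr2 :
      exec c1 s tr1 s1 -> exec c2 s1 tr2 s2 ->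
      exec (Seq c1 c2) s (tr1 ++ tr2) s2
  | exec_while_false (b : state -> bool) c s : ~~ b s -> exec (While b c) s [::] s
  | exec_while_true (b : state -> bool) c s s1 s2 tr1 tr2 :
      b s -> exec c s tr1 s1 -> exec (While b c) s1 tr2 s2 ->
      exec (While b c) s (tr1 ++ tr2) s2.

Definition accel_asc (n : nat) : cmd := (
  Assign (set_k (fun _ => 2)) ;;
  Assign (set_a (fun _ => 1) (fun _ => 0)) ;;
  Assign (set_y (fun _ => n - 1)) ;;
  While (fun s => vk s != 1) (
    Assign (set_k (fun s => vk s - 1)) ;;
    ReadSucc ;;
    While (fun s => 2 * vx s <= vy s) (
      Assign (set_a vk vx) ;;
      Assign (set_y (fun s => vy s - vx s)) ;;
      Assign (set_k (fun s => vk s + 1))) ;;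
    Assign (set_l (fun s => vk s + 1)) ;;
    While (fun s => vx s <= vy s) (
      Assign (set_a vk vx) ;;
      Assign (set_a vl vy) ;;
      Visit vl ;;
      Assign (set_x (fun s => vx s + 1)) ;;
      Assign (set_y (fun s => vy s - 1))) ;;
    Assign (set_y (fun s => vy s + vx s - 1)) ;;
    Assign (set_a vk (fun s => vy s + 1)) ;;
    Visit vk))%cmd.

(* Main.v *)
Require Import Defs.
From mathcomp Require Import all_boot all_order all_algebra.
From mathcomp Require Import zify.

Set Implicit Arguments.
Unset Strict Implicit.
Unset Printing Implicit Defensive.

(** Let [num_ge x m] count the partitions of [m] into parts at least [x]. With
    [m = x + y], the reads from just after the read that sets [x], and including
    it, until the procedure has visited the composition whose last part is [m]
    number [num_ge x m - num_ge x (m - 2)], where the second term is dropped if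
    [y < x]. If [2 * x <= y], the run splits into the run that keeps [x] as a
    part, with total [y], and the run that starts at [x + 1] with total [m]:
    this is the recurrence [num_ge x m = num_ge x (m - x) + num_ge x.+1 m]. If
    [y < 2 * x], a single read occurs. The theorem is the case [x = 1],
    [m = n]. *)

(** * Counting partitions with parts bounded below *)

Definition partitions (m : nat) : seq (seq nat) :=
  [seq map val s | s : {bseq m of 'I_m.+1}
                     in [set s : {bseq m of 'I_m.+1} | is_partition m (map val s)]].

Definition partitions_ge (x m : nat) : seq (seq nat) :=
  [seq s <- partitions m | all (leq x) s].

Definition num_ge (x m : nat) : nat := size (partitions_ge x m).

Lemma mem_partitions m s : (s \in partitions m) = is_partition m s.
Proof.
apply/imageP/idP => [[t]|part_s]; first by rewrite inE => part_t ->.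
have [t def_s] := partition_bseq part_s.
by exists t; rewrite ?inE def_s.
Qed.

Lemma mem_partitions_ge x m s :
  (s \in partitions_ge x m) = all (leq x) s && is_partition m s.
Proof. by rewrite mem_filter mem_partitions. Qed.

Lemma partitions_ge_uniq x m : uniq (partitions_ge x m).
Proof.
apply: filter_uniq; rewrite map_inj_uniq ?enum_uniq //.
by move=> s t /(inj_map val_inj)/val_inj.
Qed.

Lemma num_ge1 m : num_ge 1 m = num_partitions m.
Proof.
have all_ge1 : all (all (leq 1)) (partitions m).
  by apply/allP => s; rewrite mem_partitions => /and3P[].
by rewrite /num_ge /partitions_ge (all_filterP all_ge1) size_map -cardE.
Qed.

(** The list is nonincreasing, so its last entry is the least part; [z <= m] guards the truncated
    [m - z]. *)
Lemma is_partition_rcons m t z :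
  is_partition m (rcons t z) =
    [&& all (leq z) t, 0 < z, z <= m & is_partition (m - z) t].
Proof.
have geq_trans : transitive geq by move=> a b c /= ba cb; apply: leq_trans cb ba.
rewrite /is_partition !(sorted_pairwise geq_trans) pairwise_rcons all_rcons.
rewrite sumn_rcons (_ : (_ == m) = (z <= m) && (sumn t == m - z)); last by lia.
rewrite -[all (geq^~ z) t]/(all (leq z) t) -!andbA /=.
case: (all (leq z) t) => //=; case: (0 < z); last by rewrite andbF.
by case: (z <= m); rewrite ?andbF.
Qed.

Lemma is_partition_nil m : is_partition m [::] = (m == 0).
Proof. by rewrite /is_partition eq_sym. Qed.

Lemma num_ge_gt x m : 0 < m < x -> num_ge x m = 0.
Proof.
move=> /andP[m_gt0 lt_mx]; apply/eqP; rewrite size_eq0; apply/eqP.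
case def_L: (partitions_ge x m) => [//|s L].
have: s \in partitions_ge x m by rewrite def_L mem_head.
rewrite mem_partitions_ge; case: (lastP s) => [|t z].
  by rewrite is_partition_nil; lia.
rewrite all_rcons is_partition_rcons => /andP[/andP[le_xz _] /and4P[]]; lia.
Qed.

Lemma num_ge0 x : num_ge x 0 = 1.
Proof.
rewrite /num_ge -[1]/(size [:: [::] : seq nat]); apply/perm_size/uniq_perm => //.
  exact: partitions_ge_uniq.
move=> s; rewrite mem_partitions_ge inE; case: (lastP s) => [|t z].
  by rewrite is_partition_nil.
rewrite is_partition_rcons -size_eq0 size_rcons.
by case: z => [|z]; rewrite !andbF.
Qed.

(** Sort by the least part: if it is [x], removing it leaves a partition of [m - x]; otherwise all
    parts exceed [x]. *)
Lemma num_ge_rec x m :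
  0 < x <= m -> num_ge x m = num_ge x (m - x) + num_ge x.+1 m.
Proof.
move=> /andP[x_gt0 le_xm].
rewrite /num_ge -(size_map (rcons^~ x) (partitions_ge x (m - x))) -size_cat.
apply/perm_size/uniq_perm.
- exact: partitions_ge_uniq.
- rewrite cat_uniq !partitions_ge_uniq map_inj_uniq ?partitions_ge_uniq //=.
    rewrite andbT; apply/hasPn => s; rewrite mem_partitions_ge => /andP[gt_s _].
    apply/mapP => -[t _ def_s]; move: gt_s.
    by rewrite def_s all_rcons ltnn.
  by move=> s t /rcons_inj[].
move=> s; rewrite mem_cat !mem_partitions_ge.
case: (lastP s) => [|t z].
  rewrite is_partition_nil (gtn_eqF (leq_trans x_gt0 le_xm)) /= orbF.
  by apply/esym/mapP => -[[]].
have -> : (rcons t z \in [seq rcons u x | u <- partitions_ge x (m - x)]) =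
          (z == x) && (t \in partitions_ge x (m - x)).
  apply/mapP/andP => [[u part_u /rcons_inj[-> ->]]|[/eqP-> part_t]] //.
  by exists t.
rewrite !all_rcons mem_partitions_ge is_partition_rcons.
have [->|neq_zx] := eqVneq z x.
  by rewrite leqnn ltnn x_gt0 le_xm /= orbF; case: all.
rewrite /= [x <= z]leq_eqVlt eq_sym (negPf neq_zx) /=.
case: ltnP => //= lt_xz; rewrite [in LHS]andbCA [in RHS]andbCA.
(* As [z > x], the bounds [x] and [x.+1] on [t] both follow from [all (leq z) t]. *)
case all_t: (all (leq z) t) => //=.
have all_ge y : y <= z -> all (leq y) t.
  by move=> le_yz; apply: sub_all all_t => w; apply: leq_trans.
by rewrite !all_ge // ltnW.
Qed.

(** Two parts would already sum to at least [2 * x], so only the partition with the single part [m]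
    remains. *)
Lemma num_ge_eq1 x m : 0 < x <= m -> m < 2 * x -> num_ge x m = 1.
Proof.
have [d] := ubnP (m - x); elim: d x => // d IH x lt_d le_xm lt_m2x.
rewrite num_ge_rec //; have [<-|neq_xm] := eqVneq x m.
  by rewrite subnn num_ge0 num_ge_gt //; lia.
by rewrite num_ge_gt ?IH //; lia.
Qed.

(* At most two parts fit, so removing 2 lowers by one the choices of the smaller
   of two parts. *)
Lemma num_ge_sub2 x m :
  0 < x -> 2 * x <= m < 3 * x -> num_ge x m = (num_ge x (m - 2)).+1.
Proof.
have [d] := ubnP (m - x); elim: d x => // d IH x lt_d x_gt0 le_m.
rewrite num_ge_rec ?(@num_ge_eq1 x (m - x)) ?add1n; try lia.
congr _.+1; have [lt_m|le_xm] := ltnP m (2 * x + 2).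
  rewrite num_ge_eq1; try lia.
  have [x1|x_gt1] := leqP x 1; last by rewrite num_ge_eq1 //; lia.
  (* Here [x = 1] forces [m = 2], and what is counted is the empty partition of [0]. *)
  by rewrite (_ : m - 2 = 0) ?num_ge0 //; lia.
rewrite [RHS]num_ge_rec ?(@num_ge_eq1 x (m - 2 - x)) ?add1n; try lia.
by apply: IH; lia.
Qed.

(** * Inversion and determinism of executions *)

Lemma exec_seqP c1 c2 s tr t :
  exec (Seq c1 c2) s tr t -> exists tr1 s1 tr2,
    [/\ exec c1 s tr1 s1, exec c2 s1 tr2 t & tr = tr1 ++ tr2].
Proof. by move=> e; inversion e; subst; do 3!eexists; split; eauto. Qed.

Lemma exec_whileP (b : state -> bool) c s tr t :
  exec (While b c) s tr t ->
  if b s then exec (Seq c (While b c)) s tr t else tr = [::] /\ t = s.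
Proof.
move=> e; inversion e as [| | | |b' c' s' nbs|b' c' s' s1 s2 tr1 tr2 bs e1 e2].
  by subst; rewrite (negPf nbs).
by subst; rewrite bs; apply: exec_seq e1 e2.
Qed.

Lemma exec_while_seq (b : state -> bool) c s tr t :
  b s -> exec (Seq c (While b c)) s tr t -> exec (While b c) s tr t.
Proof.
move=> bs /exec_seqP[tr1 [s1 [tr2 [e1 e2 ->]]]].
exact: exec_while_true e1 e2.
Qed.

Lemma exec_seqA c1 c2 c3 s tr t :
  exec (Seq c1 (Seq c2 c3)) s tr t <-> exec (Seq (Seq c1 c2) c3) s tr t.
Proof.
split=> /exec_seqP[tr1 [s1 [tr2 []]]].
  move=> e1 /exec_seqP[tr3 [s3 [tr4 [e3 e4 ->]]]] ->.
  by rewrite catA; apply: exec_seq e4; apply: exec_seq e3.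
move=> /exec_seqP[tr3 [s3 [tr4 [e3 e4 ->]]]] e2 ->.
by rewrite -catA; apply: exec_seq e3 _; apply: exec_seq e4 e2.
Qed.

Lemma exec_assign_seq f c s tr t :
  exec (Seq (Assign f) c) s tr t <-> exec c (f s) tr t.
Proof.
split=> [/exec_seqP[tr1 [s1 [tr2 [e1 e2 ->]]]]|]; first by inversion e1; subst.
by rewrite -[tr]cat0s; apply: exec_seq; constructor.
Qed.

(** Makes one explicit run enough: its read count is that of every run. *)
Lemma exec_det c s tr1 s1 tr2 s2 :
  exec c s tr1 s1 -> exec c s tr2 s2 -> tr1 = tr2 /\ s1 = s2.
Proof.
move=> e1; elim: e1 tr2 s2 => {c s tr1 s1}.
- by move=> f s tr2 s2 e2; inversion e2.
- by move=> s tr2 s2 e2; inversion e2.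
- by move=> m s tr2 s2 e2; inversion e2.
- move=> c1 c2 s s1 s2 tr1 tr2 _ IH1 _ IH2 tr s'.
  case/exec_seqP=> tr3 [s3 [tr4 [/IH1[-> <-] e4 ->]]].
  by have [-> ->] := IH2 _ _ e4.
- by move=> b c s nb tr2 s2 /exec_whileP; rewrite (negPf nb) => -[-> ->].
- move=> b c s s1 s2 tr1 tr2 bs _ IH1 _ IH2 tr s' /exec_whileP; rewrite bs.
  case/exec_seqP=> tr3 [s3 [tr4 [/IH1[-> <-] e4 ->]]].
  by have [-> ->] := IH2 _ _ e4.
Qed.

(** * Counting the reads of a run *)

Definition descend : cmd :=
  While (fun s => 2 * vx s <= vy s) (
    Assign (set_a vk vx) ;;
    Assign (set_y (fun s => vy s - vx s)) ;;
    Assign (set_k (fun s => vk s + 1)))%cmd.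

Definition two_parts : cmd :=
  While (fun s => vx s <= vy s) (
    Assign (set_a vk vx) ;;
    Assign (set_a vl vy) ;;
    Visit vl ;;
    Assign (set_x (fun s => vx s + 1)) ;;
    Assign (set_y (fun s => vy s - 1)))%cmd.

Definition after_read : cmd := (
  descend ;;
  Assign (set_l (fun s => vk s + 1)) ;;
  two_parts ;;
  Assign (set_y (fun s => vy s + vx s - 1)) ;;
  Assign (set_a vk (fun s => vy s + 1)) ;;
  Visit vk)%cmd.

Definition outer : cmd :=
  While (fun s => vk s != 1) (
    Assign (set_k (fun s => vk s - 1)) ;; ReadSucc ;; after_read)%cmd.

(** Each pass raises [x] and lowers [y] by one, writes only at [k] and [k + 1], and reads
    nothing. *)
Lemma two_parts_exec s :
  0 < vx s -> vl s = (vk s).+1 -> exists tr s',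
  [/\ exec two_parts s tr s', count is_read tr = 0, vk s' = vk s,
      vx s' + vy s' = vx s + vy s & forall i, i < vk s -> va s' i = va s i].
Proof.
elim: {s}(vy s) {-2}s (leqnn (vy s)) => [|d IH] s le_d x_gt0 def_l.
  exists [::], s; split=> //; apply: exec_while_false; lia.
case: (leqP (vx s) (vy s)) => [le_xy|lt_yx]; last first.
  by exists [::], s; split=> //; apply: exec_while_false; rewrite -ltnNge.
have [] := IH (set_y (fun s => vy s - 1) (set_x (fun s => vx s + 1)
              (set_a vl vy (set_a vk vx s)))) => //=; try lia.
move=> tr [s' [e_s' tr0 k' xy' a']]; eexists _, s'; split.
- apply: exec_while_true e_s' => //.
  by do 4!(apply: exec_seq; first by constructor); constructor.
- by rewrite count_cat tr0.
- by [].
- by rewrite xy' /=; lia.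
- by move=> i lt_i; rewrite a' //= !ifF //; apply/eqP; lia.
Qed.

(* One run of the recursion underlying AccelAsc: from right after the read at
   position [k] up to the visit where the whole remainder [x + y] sits in [a_k],
   whatever the outer loop does afterwards. *)
Lemma after_read_exec s :
  0 < vx s -> 0 < vk s -> exists c s',
  [/\ vk s' = vk s, vy s' = vx s + vy s - 1,
      forall i, i < vk s -> va s' i = va s i,
      c.+1 + (if vx s <= vy s then num_ge (vx s) (vx s + vy s - 2) else 0) =
        num_ge (vx s) (vx s + vy s)
    & forall tr t, exec outer s' tr t -> exists2 tr',
        exec (after_read ;; outer) s tr' t
      & count is_read tr' = c + count is_read tr].
Proof.
(* This measure drops in both subruns, which start from [(x, y - x)] and [(x + 1, y - 1)]. *)
have [d] := ubnP (2 * vy s + vx s); elim: d s => // d IH s lt_d x_gt0 k_gt0.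
have [le_2xy|lt_y2x] := leqP (2 * vx s) (vy s).
  set s1 := set_k (fun s => vk s + 1) (set_y (fun s => vy s - vx s)
              (set_a vk vx s)).
  have [||| c1 [s1' [/= k1 y1 a1 c1E e1]]] := IH s1; rewrite /=; try lia.
  (* The first subrun preserves [a_k = x], so stepping back to [k] and reading yields [x + 1]. *)
  set s2 := set_x (fun s => va s (vk s) + 1) (set_k (fun s => vk s - 1) s1').
  have x2 : vx s2 = (vx s).+1.
    by rewrite /= k1 addnK addn1 a1 ?addn1 //= eqxx.
  have y2 : vy s2 = vy s - 1 by rewrite /= y1; lia.
  have k2 : vk s2 = vk s by rewrite /= k1; lia.
  have [||| c2 [s2' [k2' y2' a2 c2E e2]]] := IH s2; rewrite ?x2 ?y2 ?k2; try lia.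
  (* The count [c] omits the read that set [x]; the successor is the read between the two
     subruns. *)
  exists (c1 + c2.+1), s2'; split.
  - by rewrite k2' k2.
  - by rewrite y2' x2 y2; lia.
  - move=> i lt_i; rewrite a2 ?k2 //= a1 /=; last by lia.
    by rewrite ifF //; apply/eqP; lia.
  - have le_y : vx s <= vy s by lia.
    move: c2E; rewrite x2 y2 (_ : (vx s).+1 + (vy s - 1) = vx s + vy s); last lia.
    (* The test fails only for [x = 1], [y = 2], and no partition of [1] has all parts at least
       [2]. *)
    have -> : (if vx s < vy s - 1 then num_ge (vx s).+1 (vx s + vy s - 2) else 0)
              = num_ge (vx s).+1 (vx s + vy s - 2).
      by case: ifP => // ge_y; rewrite num_ge_gt //; lia.
    move: c1E; rewrite le_y ifT; last by lia.
    have le_x : 0 < vx s <= vx s + vy s by rewrite x_gt0 leq_addr.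
    have le_x2 : 0 < vx s <= vx s + vy s - 2 by clear -x_gt0 le_2xy; lia.
    rewrite (num_ge_rec le_x) (num_ge_rec le_x2) subnKC // addKn.
    rewrite (_ : vx s + vy s - 2 - vx s = vy s - 2); last first.
      by rewrite subnAC addKn.
    move=> c1E c2E; clear -c1E c2E; lia.
  (* The trace is built backwards: the second subrun is put before the continuation, then the read,
     then the first subrun. *)
  - move=> tr t /e2[tr2 e2' tr2E].
    have /e1[tr1 e1' tr1E] : exec outer s1' (Read :: tr2) t.
      apply: exec_while_seq; first by rewrite k1 addn1 eqSS -lt0n.
      apply/exec_seqA/exec_assign_seq/exec_seqA.
      by rewrite -cat1s; apply: exec_seq e2'; constructor.
    exists tr1; last by rewrite tr1E /= tr2E; lia.
    case/exec_seqA/exec_seqP: e1' => tr3 [s3 [tr4 [e3 e4 ->]]].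
    apply/exec_seqA; apply: exec_seq e4.
    apply: exec_while_seq => //.
    by apply/exec_seqA/exec_assign_seq/exec_seqA/exec_assign_seq/exec_assign_seq.
(* With [y < 2 * x] the descent is skipped and no further read occurs, so [c = 0]. *)
have [//|//| tr2 [s2 [e2 tr2E k2 xy2 a2]]] :=
  @two_parts_exec (set_l (fun s => vk s + 1) s); rewrite /= ?addn1 //.
exists 0, (set_a vk (fun s => vy s + 1) (set_y (fun s => vy s + vx s - 1) s2)).
split=> //=.
- by rewrite /= in xy2; lia.
- by move=> i lt_i; rewrite ifF ?a2 //; apply/eqP; rewrite k2 /=; lia.
- case: leqP => [le_xy|lt_yx]; first by rewrite [RHS]num_ge_sub2; lia.
  by rewrite num_ge_eq1; lia.
move=> tr t e; eexists.
  apply: exec_seq e.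
  apply: exec_seq; first by apply: exec_while_false; rewrite -ltnNge.
  apply: exec_seq; first by constructor.
  apply: exec_seq; first exact: e2.
  by do 2!(apply: exec_seq; first by constructor); constructor.
by rewrite !count_cat tr2E.
Qed.

Theorem theorem4p11 (n : nat) (hn : (0 < n)%N) (s0 : state) :
  (exists (tr : seq event) (s : state), exec (accel_asc n) s0 tr s) /\
  (forall (tr : seq event) (s : state), exec (accel_asc n) s0 tr s ->
     (count is_read tr)%:Z = (p n%:Z)%:Z - (p (n%:Z - 2))%:Z)%R.
Proof.
(* The state just after the first read: [k = 1], [x = 1], [y = n - 1]. *)
set s1 := set_x (fun s => va s (vk s) + 1) (set_k (fun s => vk s - 1)
  (set_y (fun _ => n - 1) (set_a (fun _ => 1) (fun _ => 0)
  (set_k (fun _ => 2) s0)))).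
have [//|//|c [s2 [/= k2 _ _ cE e2]]] := @after_read_exec s1.
have [|tr1 e1 tr1E] := e2 [::] s2.
  by apply: exec_while_false; rewrite k2.
have e : exec (accel_asc n) s0 (Read :: tr1) s2.
  do 3!apply/exec_assign_seq.
  apply: exec_while_seq => //; apply/exec_seqA/exec_assign_seq/exec_seqA.
  by rewrite -cat1s; apply: exec_seq e1; constructor.
split=> [|tr' s' e']; first by exists (Read :: tr1), s2.
have [<- _] := exec_det e e'.
rewrite /= tr1E /= addn0 add1n.
move: cE; rewrite subnKC // !num_ge1.
(* For [n = 1] the dropped term matches [p] being [0] at the negative integer [-1]. *)
have [n1|n_gt1] := leqP n 1.
  have -> : n = 1 by lia.
  by rewrite /p /= => <-; lia.
have -> : 0 + 1 <= n - 1 by lia.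
have -> : (n%:Z - 2 = (n - 2)%N%:Z)%R by lia.
by rewrite /p => <-; lia.
Qed.
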